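(* Let $n$ be a nonnegative integer. Then, modulo integral equivalence, there are only finitely many smooth lattice polytopes (of any dimension) with $n$ lattice points on their edges.
   Context: Let $M\cong\mathbb{Z}^d$ be a lattice, $N=\mathrm{Hom}(M,\mathbb{Z})$, $M_{\mathbb{R}}=M\otimes\mathbb{R}$, $N_{\mathbb{R}}=N\otimes\mathbb{R}$. A lattice polytope $P\subset M_{\mathbb{R}}$ is the convex hull of finitely many points of $M$. Two lattice polytopes $P\subset M_{\mathbb{R}}$, $P'\subset M'_{\mathbb{R}}$ are integrally equivalent if there is an affine map $\mathrm{aff}\,P\to\mathrm{aff}\,P'$ of affine spans mapping $M\cap\mathrm{aff}\,P$ bijectively onto $M'\cap\mathrm{aff}\,P'$ and $P$ onto $P'$. Up to integral equivalence every lattice polytope may be, and is, assumed full dimensional. The normal cone of $P$ at a vertex $u$ is $\sigma(P,u)=\{v\in N_{\mathbb{R}}:\langle u'-u,v\rangle\ge 0\ \forall u'\in P\}$. A cone is unimodular if its primitive minimal generators form a lattice basis. A full-dimensional lattice polytope is smooth if all its normal cones at vertices are unimodular (in particular it is simple). The number of lattice points on the edges of $P$ is the number of lattice points contained in the union of the one-dimensional faces of $P$. *)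

(* Defs.v *)
From mathcomp Require Import all_boot all_order all_algebra.
From mathcomp Require Import boolp classical_sets functions cardinality reals.

Set Implicit Arguments.
Unset Strict Implicit.
Unset Printing Implicit Defensive.

Import Order.TTheory GRing.Theory Num.Theory.

Local Open Scope classical_set_scope.
Local Open Scope ring_scope.

(* Coordinates: M = Z^d consists of row vectors and N = Hom(M, Z) of column
   vectors, so the pairing of M_R = R^d with N_R is the matrix product. *)

Definition to_real (R : realType) (m n : nat) (z : 'M[int]_(m, n)) :
    'M[R]_(m, n) :=
  map_mx (intr : int -> R) z.

Definition pairing (R : realType) (d : nat) (u : 'rV[R]_d) (v : 'cV[R]_d) : R :=
  (u *m v) 0 0.

Definition lattice (R : realType) (d : nat) : set 'rV[R]_d :=
  range (fun z : 'rV[int]_d => to_real R z).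
Arguments lattice R d : clear implicits.

Definition conv_hull (R : realType) (d : nat) (S : set 'rV[R]_d) :
    set 'rV[R]_d :=
  [set x | exists k (p : 'I_k -> 'rV[R]_d) (c : 'I_k -> R),
     [/\ forall i, S (p i), forall i, 0 <= c i, \sum_i c i = 1 &
         x = \sum_i c i *: p i]].

Definition aff_hull (R : realType) (d : nat) (S : set 'rV[R]_d) :
    set 'rV[R]_d :=
  [set x | exists k (p : 'I_k -> 'rV[R]_d) (c : 'I_k -> R),
     [/\ forall i, S (p i), \sum_i c i = 1 & x = \sum_i c i *: p i]].

(* The k rows of B are a basis of the direction space of the affine hull. *)
Definition has_dim (R : realType) (d : nat) (S : set 'rV[R]_d) (k : nat) :
    Prop :=
  exists (x : 'rV[R]_d) (B : 'M[R]_(k, d)),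
    row_free B /\ aff_hull S = [set x + c *m B | c in [set: 'rV[R]_k]].

Definition lattice_polytope (R : realType) (d : nat) (P : set 'rV[R]_d) :
    Prop :=
  exists S : set 'rV[R]_d,
    [/\ finite_set S, S `<=` lattice R d & P = conv_hull S].

(* The nonempty faces of P, including P itself (v = 0), when P is a
   polytope. *)
Definition is_face (R : realType) (d : nat) (P F : set 'rV[R]_d) : Prop :=
  exists v : 'cV[R]_d,
    F = [set u | P u /\ forall u', P u' -> pairing u v <= pairing u' v].

Definition is_vertex (R : realType) (d : nat) (P : set 'rV[R]_d)
    (u : 'rV[R]_d) : Prop :=
  is_face P [set u].

Definition is_edge (R : realType) (d : nat) (P F : set 'rV[R]_d) : Prop :=
  is_face P F /\ has_dim F 1.

Definition edge_lattice_points (R : realType) (d : nat) (P : set 'rV[R]_d) :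
    set 'rV[R]_d :=
  lattice R d `&` \bigcup_(F in is_edge P) F.

Definition normal_cone (R : realType) (d : nat) (P : set 'rV[R]_d)
    (u : 'rV[R]_d) : set 'cV[R]_d :=
  [set v | forall u', P u' -> 0 <= pairing (u' - u) v].

(* The case m = 0 excludes the zero vector. *)
Definition primitive_vector (d : nat) (g : 'cV[int]_d) : Prop :=
  forall (m : int) (h : 'cV[int]_d), g = m *: h -> `|m| = 1.

Definition cone_spanned (R : realType) (d k : nat) (g : 'I_k -> 'cV[int]_d)
    (I : {set 'I_k}) : set 'cV[R]_d :=
  [set v | exists c : 'I_k -> R,
     (forall i, 0 <= c i) /\ v = \sum_(i in I) c i *: to_real R (g i)].
Arguments cone_spanned R [d k] g I _.

Definition primitive_minimal_generators (R : realType) (d k : nat)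
    (sigma : set 'cV[R]_d) (g : 'I_k -> 'cV[int]_d) : Prop :=
  [/\ forall i, primitive_vector (g i),
      cone_spanned R g [set: 'I_k]%SET = sigma &
      forall I : {set 'I_k}, cone_spanned R g I = sigma -> I = [set: 'I_k]%SET].

Definition lattice_basis (d k : nat) (g : 'I_k -> 'cV[int]_d) : Prop :=
  forall v : 'cV[int]_d, exists! c : 'cV[int]_k, v = \sum_i c i 0 *: g i.

(* Cones that are not pointed, or not rational polyhedral, are not
   unimodular; for a pointed rational polyhedral cone the primitive minimal
   generators are unique up to order. *)
Definition unimodular_cone (R : realType) (d : nat) (sigma : set 'cV[R]_d) :
    Prop :=
  exists k (g : 'I_k -> 'cV[int]_d),
    primitive_minimal_generators sigma g /\ lattice_basis g.

Definition smooth_polytope (R : realType) (d : nat) (P : set 'rV[R]_d) :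
    Prop :=
  [/\ lattice_polytope P, has_dim P d &
      forall u, is_vertex P u -> unimodular_cone (normal_cone P u)].

(* f matters only on the affine hull A of P, where it must be affine. *)
Definition affine_on (R : realType) (d d' : nat) (A : set 'rV[R]_d)
    (f : 'rV[R]_d -> 'rV[R]_d') : Prop :=
  forall (t : R) x y, A x -> A y ->
    f (t *: x + (1 - t) *: y) = t *: f x + (1 - t) *: f y.

Definition integrally_equivalent (R : realType) (d d' : nat)
    (P : set 'rV[R]_d) (P' : set 'rV[R]_d') : Prop :=
  exists f : 'rV[R]_d -> 'rV[R]_d',
    [/\ set_fun (aff_hull P) (aff_hull P') f,
        affine_on (aff_hull P) f,
        set_bij (lattice R d `&` aff_hull P) (lattice R d' `&` aff_hull P') f &
        f @` P = P'].

Definition smooth_with_edge_points (R : realType) (n : nat) :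
    set {d : nat & set 'rV[R]_d} :=
  [set Q | smooth_polytope (projT2 Q) /\
           (edge_lattice_points (projT2 Q) #= `I_n)%card].
Arguments smooth_with_edge_points R n : clear implicits.

(* Main.v *)
Require Import Defs.
From mathcomp Require Import all_boot all_order all_algebra.
From mathcomp Require Import boolp classical_sets functions cardinality reals.
From mathcomp Require Import zify ring.

(* At a vertex u of a smooth polytope P the primitive edge directions w_i are a
   lattice basis, dual to the inner facet normals g_i.  Moving along w_i to the
   next vertex, at lattice distance l <= n, replaces w_i by - w_i and every other
   w_j by w_j + b_j w_i.  Convexity gives b_j >= - l.  For the upper bound,
   consider the 2-face spanned by w_i and w_j, use w_i and w_j as horizontal and
   vertical unit vectors, and climb both sides of the 2-face, starting in
   directions w_j and w_j + b_j w_i.  Consecutive primitive edge vectors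
   (x, y), (x', y') have determinant 1 and y, y' >= 1, so x / y changes by
   1 / (y y') <= 1 per edge, and there are at most n edges.  If b_j > 3 n, the
   horizontal distance between the two sides, at the height where both end,
   exceeds n; but there it is at most the lattice length of a single edge.
   Hence |b_j| <= 3 n.

   A path of improving edges from u to a maximum of g_k visits at most n
   vertices, so the coordinates of P with respect to (u, w) are bounded in terms
   of n only.  Finally d <= n, because the points u + w_i are distinct lattice
   points on edges. *)

Set Implicit Arguments.
Unset Strict Implicit.
Unset Printing Implicit Defensive.

Import Order.TTheory GRing.Theory Num.Theory.

Local Open Scope classical_set_scope.
Local Open Scope ring_scope.

(** * Maxima, bounds and counting on finite sequences *)

Lemma seq_argmax (T : eqType) (s : seq T) (p : pred T) (f : T -> int) :
  has p s ->
  exists2 x, (x \in s) && p x & forall y, y \in s -> p y -> f y <= f x.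
Proof.
elim: s => // a s IH /=.
have [/IH [x /andP[xs px] xmax] _|/hasPn nps] := boolP (has p s).
  have [pa|npa] := boolP (p a); last first.
    exists x; first by rewrite inE xs orbT.
    move=> y; rewrite inE => /predU1P[-> pa|/xmax]; last exact.
    by rewrite pa in npa.
  have [fxa|fax] := leP (f a) (f x).
    by exists x; [rewrite inE xs orbT|move=> y; rewrite inE => /predU1P[->|/xmax]].
  exists a; first by rewrite inE eqxx.
  move=> y; rewrite inE => /predU1P[->//|ys /(xmax _ ys) h].
  exact: le_trans h (ltW fax).
rewrite orbF => pa; exists a; first by rewrite inE eqxx.
move=> y; rewrite inE => /predU1P[->//|/nps npy py].
by rewrite py in npy.
Qed.

Lemma seq_bound (T : eqType) (s : seq T) (f : T -> int) :
  exists2 K, 0 <= K & forall x, x \in s -> f x <= K.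
Proof.
elim: s => [|a s [K K0 hK]]; first by exists 0.
exists (K + `|f a|); first by rewrite addr_ge0.
by move=> x; rewrite inE => /predU1P[->|/hK]; lia.
Qed.

Lemma count_lt (T : eqType) (s : seq T) (p q : pred T) (x : T) :
  {in s, forall y, p y -> q y} -> x \in s -> q x -> ~~ p x ->
  (count p s < count q s)%N.
Proof.
move=> pq xs qx npx.
have <- : count p [seq y <- s | q y] = count p s.
  rewrite -!size_filter -filter_predI size_filter size_filter.
  by apply: eq_in_count => y ys /=; case: (boolP (p y)) => // /(pq y ys) ->.
rewrite -[count q s]size_filter -(count_predC p) -addn1 leq_add2l -has_count.
by apply/hasP; exists x; rewrite // mem_filter qx.
Qed.

(** * The integer pairing and dual lattice bases *)

Section Dual.
Variable d : nat.
Implicit Types (x : 'rV[int]_d) (y : 'cV[int]_d).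

Definition dot x y : int := (x *m y) 0 0.

Lemma dotDl x1 x2 y : dot (x1 + x2) y = dot x1 y + dot x2 y.
Proof. by rewrite /dot mulmxDl mxE. Qed.

Lemma dotNl x y : dot (- x) y = - dot x y.
Proof. by rewrite /dot mulNmx mxE. Qed.

Lemma dotBl x1 x2 y : dot (x1 - x2) y = dot x1 y - dot x2 y.
Proof. by rewrite dotDl dotNl. Qed.

Lemma dotZl a x y : dot (a *: x) y = a * dot x y.
Proof. by rewrite /dot -scalemxAl mxE. Qed.

Lemma dotDr x y1 y2 : dot x (y1 + y2) = dot x y1 + dot x y2.
Proof. by rewrite /dot mulmxDr mxE. Qed.

Lemma dotNr x y : dot x (- y) = - dot x y.
Proof. by rewrite /dot mulmxN mxE. Qed.

Lemma dotZr a x y : dot x (a *: y) = a * dot x y.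
Proof. by rewrite /dot -scalemxAr mxE. Qed.

Lemma dot_suml (I : Type) (r : seq I) (P : pred I) (F : I -> 'rV[int]_d) y :
  dot (\sum_(i <- r | P i) F i) y = \sum_(i <- r | P i) dot (F i) y.
Proof. by rewrite /dot mulmx_suml summxE. Qed.

Lemma dot_sumr (I : Type) (r : seq I) (P : pred I) (F : I -> 'cV[int]_d) x :
  dot x (\sum_(i <- r | P i) F i) = \sum_(i <- r | P i) dot x (F i).
Proof. by rewrite /dot mulmx_sumr summxE. Qed.

Definition dotE := (dotDl, dotNl, dotZl, dotDr, dotNr, dotZr).

Definition dual_bases (w : 'I_d -> 'rV[int]_d) (g : 'I_d -> 'cV[int]_d) :=
  [/\ forall i j, dot (w i) (g j) = (i == j)%:R,
      forall x, x = \sum_i dot x (g i) *: w i &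
      forall y, y = \sum_i dot (w i) y *: g i].

Lemma dual_bases_mx (W G : 'M[int]_d) : W *m G = 1%:M ->
  dual_bases (fun i => row i W) (fun j => col j G).
Proof.
move=> WG; have GW := mulmx1C WG; split.
- move=> i j; have := congr1 (fun A : 'M_d => A i j) WG; rewrite /dot !mxE => <-.
  by apply: eq_bigr => k _; rewrite !mxE.
- move=> x; rewrite -[LHS]mulmx1 -GW mulmxA mulmx_sum_row.
  apply: eq_bigr => i _; congr (_ *: _); rewrite /dot !mxE.
  by apply: eq_bigr => k _; rewrite !mxE.
- move=> y; rewrite -[LHS]mul1mx -GW -mulmxA; apply/matrixP => a b.
  rewrite ord1 mxE summxE; apply: eq_bigr => i _; rewrite /dot !mxE mulrC.
  by congr (_ * _); apply: eq_bigr => k _; rewrite !mxE.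
Qed.

Lemma dual_bases_reindex w g (h : 'I_d -> 'I_d) : injective h ->
  dual_bases w g -> dual_bases (fun i => w (h i)) (fun i => g (h i)).
Proof.
move=> hi [wg ex ey]; split=> [i j|x|y]; first by rewrite wg (inj_eq hi).
- by rewrite {1}(ex x) (reindex_inj hi).
- by rewrite {1}(ey y) (reindex_inj hi).
Qed.

Lemma dual_bases_plane w g a b x : dual_bases w g -> a != b ->
  (forall m, m != a -> m != b -> dot x (g m) = 0) ->
  x = dot x (g a) *: w a + dot x (g b) *: w b.
Proof.
move=> [_ ex _] ab x0; rewrite {1}(ex x) (bigD1 a) //= (bigD1 b) 1?eq_sym //=.
rewrite big1 ?addr0 // => m /andP[ma mb].
by rewrite x0 // scale0r.
Qed.

(** The coordinates other than the [i]-th are nonnegative with sum zero, so each vanishes. *)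
Lemma dual_bases_ray w g i x : dual_bases w g ->
  (forall j, 0 <= dot x (g j)) -> dot x (\sum_(j | j != i) g j) = 0 ->
  x = dot x (g i) *: w i.
Proof.
move=> [_ ex _] x0; rewrite dot_sumr => /psumr_eq0P h.
rewrite {1}(ex x) (bigD1 i) //= big1 ?addr0 // => j ji.
by rewrite h ?scale0r.
Qed.

End Dual.

(** * Corners of a finite set of lattice points, and pivots along edges *)

Lemma shiftK (V : zmodType) (u x : V) : u + x - u = x.
Proof. by rewrite addrC addKr. Qed.

(* S may contain points that are not vertices of its hull, so u + t *: w i need
   not be the other end of the edge. *)
Definition corner d (S : seq 'rV[int]_d) (u : 'rV[int]_d)
    (w : 'I_d -> 'rV[int]_d) (g : 'I_d -> 'cV[int]_d) : Prop :=
  [/\ u \in S, dual_bases w g,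
      forall s i, s \in S -> 0 <= dot (s - u) (g i) &
      forall i, exists2 t : int, 0 < t & u + t *: w i \in S].

(* An edge step of length at most n changes a functional whose values on the
   edge directions are at most M by at most n M, and multiplies M by at most
   1 + 3 n. *)
Fixpoint climb_bound (n N : nat) (M : int) : int :=
  if N is N'.+1 then n%:Z * M + climb_bound n N' ((1 + 3 * n%:Z) * M) else 0.

Lemma climb_bound_ge0 n N M : 0 <= M -> 0 <= climb_bound n N M.
Proof.
by elim: N M => //= N IHN M M0; rewrite addr_ge0 ?mulr_ge0 ?IHN // mulr_ge0.
Qed.

Section Corners.
Variables (d : nat) (S : seq 'rV[int]_d).
Implicit Types (u s : 'rV[int]_d) (w : 'I_d -> 'rV[int]_d)
  (g : 'I_d -> 'cV[int]_d).

(* v = K * (sum of the g_j, j <> i) - g_i with K large. *)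
Lemma tilted_functional u w g i : dual_bases w g ->
  (forall s i, s \in S -> 0 <= dot (s - u) (g i)) ->
  exists2 v, dot (w i) v = -1 &
    forall s, s \in S ->
      0 <= dot (s - u) v \/ s = u + dot (s - u) (g i) *: w i.
Proof.
move=> wg pos; have [wgE _ _] := wg.
have [K K0 hK] := seq_bound S (fun s => dot (s - u) (g i)).
exists (K *: (\sum_(j | j != i) g j) - g i).
  rewrite !dotE wgE eqxx dot_sumr big1 ?mulr0 ?sub0r // => j ji.
  by rewrite wgE eq_sym (negPf ji).
move=> s sS; set v0 := \sum_(j | _) _.
have v0pos : 0 <= dot (s - u) v0.
  by rewrite dot_sumr sumr_ge0 // => j _; exact: pos.
have [v00|v0n0] := eqVneq (dot (s - u) v0) 0.
  right; apply/eqP; rewrite addrC -subr_eq; apply/eqP.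
  by apply: dual_bases_ray v00 => // j; exact: pos.
(* The integer [dot (s - u) v0] is now at least 1, so [K] outweighs the [g i] term. *)
left; rewrite dotDr dotNr dotZr; have := hK _ sS.
by nia.
Qed.

(** The only form in which smoothness enters this section; for a smooth polytope it comes from
    [unimodular_corner]. *)
Hypothesis vertex_corner : forall u v, u \in S ->
  (forall s, s \in S -> s != u -> 0 < dot (s - u) v) ->
  exists w g, corner S u w g.

Lemma corner_reindex u w g (h : 'I_d -> 'I_d) : injective h ->
  corner S u w g -> corner S u (fun i => w (h i)) (fun i => g (h i)).
Proof.
move=> hi [uS wg pos ray]; split=> //; first exact: dual_bases_reindex.
by move=> s i; exact: pos.
Qed.

(** The end is the last point of [S] on the ray. A tilted functional falls by 1 per step along the
    ray and stays at least its value at [u] elsewhere on [S], so its unique minimum is that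
    point. *)
Lemma edge_end u w g i : corner S u w g ->
  exists l : int, [/\ 0 < l, u + l *: w i \in S,
    forall t, u + t *: w i \in S -> t <= l &
    exists w' g', corner S (u + l *: w i) w' g'].
Proof.
move=> [uS wg pos ray]; have [wgE _ _] := wg.
have ut t : dot (u + t *: w i - u) (g i) = t.
  by rewrite shiftK dotZl wgE eqxx mulr1.
have [t0 t0pos t0S] := ray i.
have : has (fun s => s == u + dot (s - u) (g i) *: w i) S.
  by apply/hasP; exists (u + t0 *: w i); rewrite ?ut.
move=> /(@seq_argmax _ _ _ (fun s => dot (s - u) (g i))).
case=> u' /andP[u'S /eqP u'E] u'max.
set l := dot (u' - u) (g i) in u'E.
have lmax t : u + t *: w i \in S -> t <= l.
  by move=> tS; rewrite -(ut t); apply: u'max => //; rewrite ut.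
have l0 : 0 < l by rewrite (lt_le_trans t0pos) // lmax.
exists l; split=> //; first by rewrite -u'E.
rewrite -u'E; have [v wv hv] := tilted_functional i wg pos.
apply: (@vertex_corner u' v) => // s sS su'.
have -> : dot (s - u') v = dot (s - u) v + l.
  by rewrite u'E !dotE wv; lia.
have [h|sE] := hv _ sS; first by lia.
have le : dot (s - u) (g i) <= l by apply: lmax; rewrite -sE.
have ne : dot (s - u) (g i) != l.
  by apply: contraNneq su' => e; rewrite sE e -u'E.
rewrite {1}sE shiftK dotZl wv.
by lia.
Qed.

(** The functional [v0] is nonnegative on every [w' m] and vanishes on [u - u'], a nonnegative
    combination of the [w' m]. Hence some [w' m] is parallel to the edge, and primitivity with the
    maximality of [l] makes it [- w i]. *)
Lemma corner_back u w g i l w' g' : corner S u w g -> 0 < l ->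
  (forall t, u + t *: w i \in S -> t <= l) ->
  corner S (u + l *: w i) w' g' -> exists i', w' i' = - w i.
Proof.
set u' := u + l *: w i.
move=> [uS wg pos ray] l0 lmax [u'S wg' pos' ray'].
have [wgE ex ey] := wg; have [wgE' ex' ey'] := wg'.
pose v0 := \sum_(j | j != i) g j.
have wv0 : dot (w i) v0 = 0.
  by rewrite dot_sumr big1 // => j ji; rewrite wgE eq_sym (negPf ji).
have su' s v : dot (w i) v = 0 -> dot (s - u') v = dot (s - u) v.
  by move=> e; rewrite /u' !dotE e mulr0 addr0.
have v0pos s : s \in S -> 0 <= dot (s - u) v0.
  by move=> sS; rewrite dot_sumr sumr_ge0 // => j _; exact: pos.
have cpos m : 0 <= dot (w' m) v0.
  have [t t0 tS] := ray' m; have := v0pos _ tS.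
  rewrite -su' // shiftK dotZl.
  by rewrite pmulr_rge0.
have wn0 : w i != 0.
  by apply: contra_eqN (wgE i i) => /eqP->; rewrite eqxx /dot mul0mx mxE eq_sym oner_eq0.
have [m ln0] : exists m, dot (u - u') (g' m) != 0.
  apply/existsP; apply: contraT; rewrite negb_exists => /forallP h.
  have : u - u' = 0.
    rewrite (ex' (u - u')) big1 // => m _.
    by have := h m; rewrite negbK => /eqP->; rewrite scale0r.
  rewrite /u' opprD addNKr => /eqP; rewrite oppr_eq0 scalemx_eq0 (negPf wn0) orbF.
  by move=> /eqP l00; rewrite l00 in l0.
have cm0 : dot (w' m) v0 = 0.
  have : dot (u - u') v0 = 0 by rewrite su' // subrr /dot mul0mx mxE.
  rewrite (ex' (u - u')) dot_suml => /psumr_eq0P h.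
  have kpos k : true -> 0 <= dot (dot (u - u') (g' k) *: w' k) v0.
    by move=> _; rewrite dotZl mulr_ge0 ?pos'.
  by have /eqP := h kpos m isT; rewrite dotZl mulf_eq0 (negPf ln0) => /eqP.
exists m; have [t t0 tS] := ray' m.
pose r := dot (u' + t *: w' m - u) (g i).
have sE : u' + t *: w' m - u = r *: w i.
  apply: (dual_bases_ray wg); first by move=> j; exact: pos.
  by rewrite -/v0 -su' // shiftK dotZl cm0 mulr0.
have twm : t *: w' m = (r - l) *: w i.
  by rewrite scalerBl -sE /u' -[X in X - u]addrA !shiftK.
have rl : r <= l by apply: lmax; rewrite -sE addrC subrK.
have e1 := congr1 (fun x => dot x (g' m)) twm.
have e2 := congr1 (fun x => dot x (g i)) twm.
rewrite /= !dotZl wgE' eqxx mulr1 in e1; rewrite /= !dotZl wgE eqxx mulr1 in e2.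
have tE : r - l = - t.
  (* The integers [x] and [y] have product 1, and [r <= l] with [0 < t] makes both equal to -1. *)
  move: e1 e2 rl t0; clear; set x := dot _ _; set y := dot _ _ => e1 e2 rl t0.
  have xy : x * y = 1 by apply: (mulfI (lt0r_neq0 t0)); rewrite mulr1 [RHS]e1 -e2; ring.
  have y0 : y <= 0 by rewrite -(pmulr_rle0 _ t0) e2 subr_le0.
  have x0 : x < 0 by nia.
  have y1 : y = -1 by nia.
  by rewrite -e2 y1 mulrN1.
apply/eqP; rewrite -subr_eq0 opprK; have /eqP := twm.
rewrite tE scaleNr -subr_eq0 opprK -scalerDr scalemx_eq0.
by case/orP=> // /eqP t00; rewrite t00 in t0.
Qed.

(* The coordinates of the g j (j != i) in terms of the g' m (m != i') and
   conversely are nonnegative integers, so these matrices are mutually inverse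
   permutation matrices. *)
Lemma corner_facet u w g i l w' g' i' j : corner S u w g ->
  corner S (u + l *: w i) w' g' -> w' i' = - w i -> j != i ->
  exists2 m, m != i' & g' m = g j.
Proof.
set u' := u + l *: w i.
move=> [uS wg pos ray] [u'S wg' pos' ray'] back ji.
have [wgE ex ey] := wg; have [wgE' ex' ey'] := wg'.
have wij : dot (w i) (g j) = 0 by rewrite wgE eq_sym (negPf ji).
have Cpos m : 0 <= dot (w' m) (g j).
  have [t t0 tS] := ray' m; have := pos _ j tS.
  by rewrite /u' -[u + _ + _]addrA shiftK !dotE wij mulr0 add0r pmulr_rge0.
have wi0 m : m != i' -> dot (w i) (g' m) = 0.
  move=> mi; rewrite -[w i]opprK -back dotNl wgE' eq_sym (negPf mi).
  by rewrite oppr0.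
have Dpos k m : m != i' -> 0 <= dot (w k) (g' m).
  move=> mi; have [t t0 tS] := ray k; have := pos' _ m tS.
  rewrite /u' opprD addrA shiftK !dotE wi0 // mulr0 subr0.
  by rewrite pmulr_rge0.
have wgk k : (k == j)%:R = \sum_m dot (w' m) (g j) * dot (w k) (g' m).
  rewrite -wgE {1}(ey' (g j)) dot_sumr.
  by apply: eq_bigr => m _; rewrite dotZr.
have CD0 k m : true -> 0 <= dot (w' m) (g j) * dot (w k) (g' m).
  move=> _; have [->|mi] := eqVneq m i'; last by rewrite mulr_ge0 ?Dpos.
  by rewrite back dotNl wij oppr0 mul0r.
have [m CDn0] : exists m, dot (w' m) (g j) * dot (w j) (g' m) != 0.
  apply/existsP; apply: contraT; rewrite negb_exists => /forallP h.
  have := wgk j; rewrite eqxx big1 // => m _.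
  by have := h m; rewrite negbK => /eqP.
have mi : m != i'.
  apply: contraNneq CDn0 => ->.
  by rewrite back dotNl wij oppr0 mul0r.
exists m => //; have Cm := Cpos m; have Dm := Dpos j m mi.
have CD1 : dot (w' m) (g j) * dot (w j) (g' m) <= 1.
  have := wgk j; rewrite eqxx (bigD1 m) //= => e; rewrite [X in _ <= X]e.
  by rewrite lerDl sumr_ge0 // => k _; exact: CD0.
have D1 : dot (w j) (g' m) = 1.
  move: Cm Dm CD1 CDn0; clear; set x := dot _ _; set y := dot _ _ => x0 y0 le1 n0.
  have xy1 : x * y = 1 by have := mulr_ge0 x0 y0; lia.
  have xn0 : x != 0 by apply: contraNneq n0 => ->; rewrite mul0r.
  have yn0 : y != 0 by apply: contraNneq n0 => ->; rewrite mulr0.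
  have xp : 1 <= x by lia.
  have ylt2 : y < 2 by nia.
  by lia.
have Cn0 : dot (w' m) (g j) != 0 by apply: contraNneq CDn0 => ->; rewrite mul0r.
rewrite (ey (g' m)) (bigD1 j) //= D1 scale1r big1 ?addr0 // => k kj.
have := wgk k; rewrite (negPf kj) => /esym/(psumr_eq0P (CD0 k))/(_ m isT)/eqP.
by rewrite mulf_eq0 (negPf Cn0) => /eqP->; rewrite scale0r.
Qed.

(** Reindexing by [h] gives shared facets the same index at both ends, and index [i] to the
    direction pointing back. Then [w' j - w j] pairs to zero with every [g m], [m != i], so it is a
    multiple of [w i]. *)
Lemma pivot u w g i : corner S u w g ->
  exists l (b : 'I_d -> int) w' g',
    [/\ corner S (u + l *: w i) w' g', 0 < l, w' i = - w i,
        forall j, j != i -> w' j = w j + b j *: w i /\ - l <= b j &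
        forall j, j != i -> g' j = g j].
Proof.
move=> C; have [l [l0 lS lmax [w' [g' C']]]] := edge_end i C.
have [i' back] := corner_back C l0 lmax C'.
have /boolp.choice[h hP] : forall j, exists m,
    if j == i then m = i' else m != i' /\ g' m = g j.
  move=> j; have [_|ji] := eqVneq j i; first by exists i'.
  by have [m mi mE] := corner_facet C C' back ji; exists m.
have [_ wg pos _] := C; have [wgE ex _] := wg.
have hi : h i = i' by have := hP i; rewrite eqxx.
have hj j : j != i -> h j != i' /\ g' (h j) = g j.
  by move=> ji; have := hP j; rewrite (negPf ji).
have h_inj : injective h.
  move=> j k; have [->|ji] := eqVneq j i; have [->|ki] := eqVneq k i => //.
  - by rewrite hi => e; have [] := hj k ki; rewrite -e eqxx.
  - by rewrite hi => e; have [] := hj j ji; rewrite e eqxx.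
  move=> e; have [_ gj] := hj j ji; have [_ gk] := hj k ki.
  have := wgE j k; rewrite -gk -e gj wgE eqxx.
  by case: eqVneq.
have {}C' := corner_reindex h_inj C'.
have [_ [wgE' _ _] _ ray'] := C'.
have wi : w' (h i) = - w i by rewrite hi.
exists l, (fun j => dot (w' (h j)) (g i)), (fun j => w' (h j)), (fun j => g' (h j)).
split=> // j ji; last by have [] := hj j ji.
have wjE : w' (h j) = w j + dot (w' (h j)) (g i) *: w i.
  apply/eqP; rewrite addrC -subr_eq; apply/eqP.
  have e m : m != i -> dot (w' (h j) - w j) (g m) = 0.
    by move=> mi; rewrite !dotE wgE -[in X in X - _](hj m mi).2 wgE' subrr.
  rewrite [LHS]ex (bigD1 i) //= big1 ?addr0; last first.
    by move=> m mi; rewrite e // scale0r.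
  by rewrite dotBl wgE (negPf ji) subr0.
(* A point of [S] on the new ray has [g i]-coordinate [l + t * b] at least 0, with [b] the shear
   coefficient and [t >= 1]. *)
split=> //; have [t t0 tS] := ray' j; have := pos _ i tS.
rewrite -[u + _ + _]addrA shiftK !dotE wgE eqxx mulr1.
by nia.
Qed.

(* A point of S of maximal Euclidean norm is a vertex. *)
Lemma exists_corner : S != [::] -> exists u w g, corner S u w g.
Proof.
move=> S0; have : has predT S by case: (S) S0.
move=> /(@seq_argmax _ _ _ (fun s => dot s s^T))[u /andP[uS _] umax].
exists u; apply: (@vertex_corner u (- u^T)) => // s sS su.
have := umax s sS isT.
have dotC (a b : 'rV[int]_d) : dot a b^T = dot b a^T.
  by rewrite /dot -[a in LHS]trmxK -trmx_mul mxE.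
have : 0 < dot (s - u) (s - u)^T.
  have -> : dot (s - u) (s - u)^T = \sum_i (s - u) 0 i ^+ 2.
    by rewrite /dot mxE; apply: eq_bigr => i _; rewrite [_^T _ _]mxE.
  have sq0 i : true -> 0 <= (s - u) 0 i ^+ 2 by rewrite sqr_ge0.
  rewrite lt0r sumr_ge0 // andbT; apply: contra su.
  move=> /eqP/(psumr_eq0P sq0) h; rewrite -subr_eq0; apply/eqP/rowP => j.
  by apply/eqP; rewrite [X in _ == X]mxE -sqrf_eq0 h.
have -> : (s - u)^T = s^T - u^T by rewrite linearB.
rewrite !dotE (dotC u s).
by move: (dot s s^T) (dot s u^T) (dot u u^T) => a b c; lia.
Qed.

(** * Bounds on shears and coordinates in terms of [n] *)

Variables (n : nat) (corners : seq 'rV[int]_d).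
Hypothesis edge_length : forall u w g i t,
  corner S u w g -> u + t *: w i \in S -> t <= n%:Z.
Hypothesis mem_corners : forall u w g, corner S u w g -> u \in corners.
Hypothesis size_corners : (size corners <= n)%N.

(* Decreases at each step of a y-increasing walk along edges. *)
Definition num_above (y : 'cV[int]_d) (u : 'rV[int]_d) : nat :=
  count (fun s => dot u y < dot s y) corners.

Lemma num_above_le y u : (num_above y u <= n)%N.
Proof. exact: leq_trans (count_size _ _) size_corners. Qed.

Lemma num_above_lt y u u' : u' \in corners -> dot u y < dot u' y ->
  (num_above y u' < num_above y u)%N.
Proof.
move=> u'c lt; apply: (@count_lt _ _ _ _ u') => //; last by rewrite ltxx.
by move=> s _; exact: lt_trans.
Qed.

(* The walk stays in the 2-face of directions a and a'; w a is the next edge and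
   w a' points back along the previous one, so a and a' swap at each step.  The
   slope x / y of the next edge, at most A at the start, grows by at most 1 per
   edge.  The walk stops at a vertex of maximal y in the 2-face. *)
Lemma two_face_climb N u w g a a' (x y : 'cV[int]_d) (A : int) :
  corner S u w g -> a != a' -> (num_above y u <= N)%N ->
  0 < dot (w a) y ->
  dot (w a') x * dot (w a) y - dot (w a) x * dot (w a') y = 1 ->
  dot (w a) x <= A * dot (w a) y ->
  exists q v h c c',
    [/\ corner S q v h, (c = a /\ c' = a') \/ (c = a' /\ c' = a),
      forall m, m != a -> m != a' -> h m = g m /\ dot q (g m) = dot u (g m),
      [/\ dot (v c) y <= 0, dot (v c') y < 0 &
        dot (v c') x * dot (v c) y - dot (v c) x * dot (v c') y = 1] &
      dot u y < dot q y /\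
      dot q x - dot u x <= (A + N%:Z) * (dot q y - dot u y)].
Proof.
elim: N u w g a a' A => [|N IHN] u w g a a' A C aa' leN ya orient slope;
  have [l [b [w' [g' [C' l0 wa wj gj]]]]] := pivot a C;
  set u' := u + l *: w a in C';
  have yu' : dot u y < dot u' y by rewrite /u' !dotE ltrDl mulr_gt0.
(* For [N = 0] no corner is higher than [u], yet the pivot reaches one. *)
- by have := num_above_lt (mem_corners C') yu'; rewrite ltnNge (leq_trans leN).
all: have a'a : a' != a by rewrite eq_sym.
have [wa' _] := wj _ a'a.
have lt_u' := num_above_lt (mem_corners C') yu'.
have wg : forall m, m != a -> dot (w a) (g m) = 0.
  by move=> m ma; have [_ [wgE _ _] _ _] := C; rewrite wgE eq_sym (negPf ma).
have orient' : dot (w' a) x * dot (w' a') y - dot (w' a') x * dot (w' a) y = 1.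
  by rewrite wa wa' !dotE -[RHS]orient; ring.
have disp : dot u' x - dot u x <= (A + N.+1%:Z) * (dot u' y - dot u y).
  rewrite /u' !dotE ![_ + l * _ - _]addrAC !subrr !add0r.
  by nia.
have y'a : dot (w' a) y < 0 by rewrite wa dotNl oppr_lt0.
have [y'le0|y'gt0] := leP (dot (w' a') y) 0.
  (* The 2-face climbs no further: [u'] is its top, and [a], pointing back, strictly descends. *)
  exists u', w', g', a', a; split; [exact: C'|by right| |by []|by []].
  by move=> m ma _; rewrite gj // /u' !dotE wg // mulr0 addr0.
have slope' : dot (w' a') x <= (A + 1) * dot (w' a') y.
  move: y'gt0 ya slope orient'; rewrite wa !dotNl.
  set X' := dot (w' a') x; set Y' := dot (w' a') y.
  set X := dot (w a) x; set Y := dot (w a) y.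
  (* By [o], [X' / Y' = X / Y + 1 / (Y * Y')], and [Y * Y' >= 1]. *)
  move=> Y'0 Y0 s o; rewrite -(ler_pM2r Y0).
  have -> : X' * Y = 1 + X * Y' by rewrite -o; ring.
  have := ler_wpM2r (ltW Y'0) s.
  have : 1 <= Y * Y' by nia.
  by nia.
have leN' : (num_above y u' <= N)%N by rewrite -ltnS (leq_trans lt_u').
have [q [v [h [c [c' [Cq cc hm top [yq xq]]]]]]] :=
  IHN _ _ _ _ _ _ C' a'a leN' y'gt0 orient' slope'.
exists q, v, h, c, c'; split=> //; first by case: cc; [right|left].
  move=> m ma ma'; have [-> qg] := hm _ ma' ma; split; first exact: gj.
  by rewrite -(gj m ma) qg gj // /u' !dotE wg // mulr0 addr0.
split; first exact: lt_trans yq.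
have -> : dot q x - dot u x = (dot q x - dot u' x) + (dot u' x - dot u x).
  by ring.
move: xq disp; rewrite -[N.+1]addn1 PoszD.
by nia.
Qed.

(** With [H >= 1] the height of the top, the left climb ends at most [n * H] to the right of [u],
    the right one at least [l + (b - n) * H]. The gap at the top is at most [n], so
    [l + (b - 2 * n) * H <= n]. *)
Lemma pivot_shear_le u w g i j l b w' g' : corner S u w g -> 0 < l ->
  corner S (u + l *: w i) w' g' -> w' i = - w i -> w' j = w j + b *: w i ->
  j != i -> (forall m, m != i -> g' m = g m) -> b <= 3 * n%:Z.
Proof.
set u' := u + l *: w i => C l0 C' w'i w'j ji gE.
have ij : i != j by rewrite eq_sym.
have [uS wgb _ _] := C; have [wg _ _] := wgb.
set x := g i; set y := g j.
have [wjx wjy] : dot (w j) x = 0 /\ dot (w j) y = 1.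
  by rewrite !wg (negPf ji) eqxx.
have [wix wiy] : dot (w i) x = 1 /\ dot (w i) y = 0.
  by rewrite !wg (negPf ij) eqxx.
have [qL [vL [hL [c [c' [CL cL hmL [ycL yc'L oL] [yqL xqL]]]]]]] :
    exists q v h c c',
    [/\ corner S q v h, (c = j /\ c' = i) \/ (c = i /\ c' = j),
      forall m, m != j -> m != i -> h m = g m /\ dot q (g m) = dot u (g m),
      [/\ dot (v c) y <= 0, dot (v c') y < 0 &
        dot (v c') x * dot (v c) y - dot (v c) x * dot (v c') y = 1] &
      dot u y < dot q y /\
      dot q x - dot u x <= (0 + n%:Z) * (dot q y - dot u y)].
  apply: two_face_climb C ji (num_above_le _ _) _ _ _; rewrite ?wjy ?wjx //.
  by rewrite wix wiy.
(* Replacing [x] by [- x] mirrors the right side and so restores the orientation; the initial slope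
   is [- b]. *)
have [qR [vR [hR [e [e' [CR cR hmR [yeR ye'R oR] [yqR xqR]]]]]]] :
    exists q v h c c',
    [/\ corner S q v h, (c = j /\ c' = i) \/ (c = i /\ c' = j),
      forall m, m != j -> m != i -> h m = g' m /\ dot q (g' m) = dot u' (g' m),
      [/\ dot (v c) y <= 0, dot (v c') y < 0 &
        dot (v c') (- x) * dot (v c) y - dot (v c) (- x) * dot (v c') y = 1] &
      dot u' y < dot q y /\
      dot q (- x) - dot u' (- x) <= (- b + n%:Z) * (dot q y - dot u' y)].
  apply: two_face_climb C' ji (num_above_le _ _) _ _ _;
    rewrite ?w'i ?w'j !dotE ?wjy ?wjx ?wix ?wiy; lia.
have u'y : dot u' y = dot u y by rewrite /u' !dotE wiy mulr0 addr0.
have u'x : dot u' x = dot u x + l by rewrite /u' !dotE wix mulr1.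
have qLR m : m != i -> m != j -> dot qL (g m) = dot qR (g m).
  move=> mi mj; rewrite (hmL _ mj mi).2 -gE // (hmR _ mj mi).2 gE //.
  by rewrite /u' !dotE wg eq_sym (negPf mi) mulr0 addr0.
(* Both tops lie in the same 2-face, so their difference involves only its two edge directions. *)
have dec q q' v h k k' : corner S q v h -> q' \in S ->
    (k = j /\ k' = i) \/ (k = i /\ k' = j) ->
    (forall m, m != j -> m != i -> h m = g m) ->
    (forall m, m != i -> m != j -> dot q' (g m) = dot q (g m)) ->
    exists al be, [/\ 0 <= al, 0 <= be & q' = q + (al *: v k + be *: v k')].
  move=> [_ vhb pos _] q'S kk hm qq'.
  have kk' : k != k' by case: kk => [[-> ->]|[-> ->]].
  exists (dot (q' - q) (h k)), (dot (q' - q) (h k')).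
  split; [exact: pos|exact: pos|].
  rewrite -(dual_bases_plane (x := q' - q) vhb kk'); first by rewrite addrC subrK.
  move=> m mk mk'; have [mi mj] : m != i /\ m != j.
    by case: kk mk mk' => [[-> ->]|[-> ->]].
  by rewrite hm // dotBl qq' // subrr.
have [al [be [al0 be0 qRE]]] : exists al be,
    [/\ 0 <= al, 0 <= be & qR = qL + (al *: vL c + be *: vL c')].
  apply: dec CL _ cL _ _; first by case: CR.
    by move=> m mj mi; case: (hmL m mj mi).
  by move=> m mi mj; rewrite qLR.
have [al' [be' [al'0 be'0 qLE]]] : exists al be,
    [/\ 0 <= al, 0 <= be & qL = qR + (al *: vR e + be *: vR e')].
  apply: dec CR _ cR _ _; first by case: CL.
    by move=> m mj mi; have [-> _] := hmR m mj mi; rewrite gE.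
  by move=> m mi mj; rewrite qLR.
have yRL : dot qR y = dot qL y + (al * dot (vL c) y + be * dot (vL c') y).
  by rewrite {1}qRE !dotE.
have yLR : dot qL y = dot qR y + (al' * dot (vR e) y + be' * dot (vR e') y).
  by rewrite {1}qLE !dotE.
have n1 : al * dot (vL c) y <= 0 by rewrite mulr_ge0_le0.
have n2 : be * dot (vL c') y <= 0 by rewrite mulr_ge0_le0 // ltW.
have n3 : al' * dot (vR e) y <= 0 by rewrite mulr_ge0_le0.
have n4 : be' * dot (vR e') y <= 0 by rewrite mulr_ge0_le0 // ltW.
(* Neither top has an ascending edge in the 2-face, so neither is lower than the other. Since
   [vL c'] strictly descends, the tops coincide or differ by a horizontal edge. *)
have yE : dot qR y = dot qL y by lia.
have be00 : be = 0.
  have /eqP : be * dot (vL c') y = 0 by lia.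
  by rewrite mulf_eq0 (lt_eqF yc'L) orbF => /eqP.
rewrite be00 scale0r addr0 in qRE.
have al00 : al * dot (vL c) y = 0 by lia.
have width : dot qR x - dot qL x <= n%:Z.
  rewrite qRE dotDl dotZl addrAC subrr add0r.
  have [->|aln0] := eqVneq al 0; first by rewrite mul0r.
  have yc0 : dot (vL c) y = 0.
    by have /eqP := al00; rewrite mulf_eq0 (negPf aln0) => /eqP.
  have aln : al <= n%:Z by apply: (edge_length CL (i := c)); rewrite -qRE; case: CR.
  (* For horizontal [vL c], the determinant [oL] is a product of two integers equal to 1. *)
  have xc : dot (vL c) x <= 1.
    by move: oL yc'L; rewrite yc0; clear; nia.
  by nia.
move: xqL xqR yqL; rewrite !dotNr yE u'y u'x.
move: width l0; clear.
set H := dot qL y - dot u y => width l0 xL xR yL.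
have H1 : 1 <= H by rewrite /H; lia.
by nia.
Qed.

Lemma climb N q w g (f : 'cV[int]_d) M : corner S q w g ->
  (num_above f q <= N)%N -> 0 <= M -> (forall j, `|dot (w j) f| <= M) ->
  forall s, s \in S -> dot s f - dot q f <= climb_bound n N M.
Proof.
elim: N q w g M => [|N IHN] q w g M C leN M0 hM s sS;
  have [qS [wg ex _] pos _] := C;
  (have [[i fi]|nfi] := pselect (exists i, 0 < dot (w i) f); last first).
1, 3: apply: le_trans (climb_bound_ge0 _ _ M0).
(* Without an improving edge [q] maximizes [f] on [S], as [s - q] is a nonnegative combination of
   the [w j]. *)
1, 2: rewrite -dotBl (ex (s - q)) dot_suml sumr_le0 // => j _.
1, 2: by rewrite dotZl mulr_ge0_le0 ?pos // leNgt; apply/negP => fj; apply: nfi; exists j.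
all: have [l [b [w' [g' [C' l0 w'i w'j gj]]]]] := pivot i C.
all: have ln : l <= n%:Z by apply: (edge_length C (i := i)); case: C'.
all: set q' := q + l *: w i in C'.
all: have fq' : dot q' f = dot q f + l * dot (w i) f by rewrite /q' !dotE.
all: have lt_q' : (num_above f q' < num_above f q)%N
  by apply: num_above_lt (mem_corners C') _; rewrite fq' ltrDl mulr_gt0.
  by rewrite leqNgt (leq_ltn_trans _ lt_q') in leN.
have hM' j : `|dot (w' j) f| <= (1 + 3 * n%:Z) * M.
  have [->|ji] := eqVneq j i; first by rewrite w'i dotNl normrN; have := hM i; nia.
  have [w'jE lb] := w'j j ji.
  have ub := pivot_shear_le C l0 C' w'i w'jE ji gj.
  rewrite w'jE dotDl dotZl (le_trans (ler_normD _ _)) // mulrDl mul1r lerD //.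
  by rewrite normrM ler_pM // ler_norml; lia.
have leN' : (num_above f q' <= N)%N by rewrite -ltnS (leq_trans lt_q').
have M'0 : 0 <= (1 + 3 * n%:Z) * M by rewrite mulr_ge0.
have := IHN q' w' g' _ C' leN' M'0 hM' s sS; rewrite fq' /=.
have := hM i; have := ler_norm (dot (w i) f).
by nia.
Qed.

(** The functional climbed is [g i], with values 0 and 1 on the edge directions at [u]; hence
    [M = 1]. *)
Lemma corner_box u w g s i : corner S u w g -> s \in S ->
  dot (s - u) (g i) <= climb_bound n n 1.
Proof.
move=> C sS; rewrite dotBl; apply: (climb C (num_above_le _ _)) => // j.
have [_ [-> _ _] _ _] := C.
by case: eqP; rewrite ?normr1 ?normr0.
Qed.

End Corners.

(** * Passage between integer points and real convex hulls *)

Section RealPolytopes.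
Variables (R : realType) (d : nat).
Implicit Types (x : 'rV[R]_d) (v : 'cV[R]_d).

Lemma to_realD m n (A B : 'M[int]_(m, n)) :
  to_real R (A + B) = to_real R A + to_real R B.
Proof. exact: map_mxD. Qed.

Lemma to_realB m n (A B : 'M[int]_(m, n)) :
  to_real R (A - B) = to_real R A - to_real R B.
Proof. exact: map_mxB. Qed.

Lemma to_realZ m n (a : int) (A : 'M[int]_(m, n)) :
  to_real R (a *: A) = a%:~R *: to_real R A.
Proof. exact: map_mxZ. Qed.

Lemma to_realM m n p (A : 'M[int]_(m, n)) (B : 'M[int]_(n, p)) :
  to_real R (A *m B) = to_real R A *m to_real R B.
Proof. exact: map_mxM. Qed.

Lemma to_real_inj m n : injective (@to_real R m n).
Proof.
move=> A B /matrixP AB; apply/matrixP => i j.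
by have /eqP := AB i j; rewrite !mxE eqr_int => /eqP.
Qed.

Lemma pairingBl x1 x2 v : pairing (x1 - x2) v = pairing x1 v - pairing x2 v.
Proof. by rewrite /pairing mulmxBl !mxE. Qed.

Lemma pairingZl a x v : pairing (a *: x) v = a * pairing x v.
Proof. by rewrite /pairing -scalemxAl mxE. Qed.

Lemma pairingZr a x v : pairing x (a *: v) = a * pairing x v.
Proof. by rewrite /pairing -scalemxAr mxE. Qed.

Lemma pairing_suml (I : Type) (r : seq I) (P : pred I) (F : I -> 'rV[R]_d) v :
  pairing (\sum_(i <- r | P i) F i) v = \sum_(i <- r | P i) pairing (F i) v.
Proof. by rewrite /pairing mulmx_suml summxE. Qed.

Lemma pairing_sumr (I : Type) (r : seq I) (P : pred I) (F : I -> 'cV[R]_d) x :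
  pairing x (\sum_(i <- r | P i) F i) = \sum_(i <- r | P i) pairing x (F i).
Proof. by rewrite /pairing mulmx_sumr summxE. Qed.

Lemma pairing_to_real (x : 'rV[int]_d) (y : 'cV[int]_d) :
  pairing (to_real R x) (to_real R y) = (dot x y)%:~R.
Proof. by rewrite /pairing -to_realM mxE. Qed.

Lemma conv_hull_sub (A : set 'rV[R]_d) : A `<=` conv_hull A.
Proof.
move=> x Ax; exists 1%N, (fun=> x), (fun=> 1); split=> //.
  by rewrite big_ord1.
by rewrite big_ord1 scale1r.
Qed.

Lemma conv_hull_segment (A : set 'rV[R]_d) x1 x2 (t : R) : A x1 -> A x2 ->
  0 <= t <= 1 -> conv_hull A ((1 - t) *: x1 + t *: x2).
Proof.
move=> A1 A2 /andP[t0 t1].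
exists 2%N, (fun i => if val i == 0%N then x1 else x2),
  (fun i => if val i == 0%N then 1 - t else t); split.
- by move=> i; case: ifP.
- by move=> i; case: ifP; rewrite ?subr_ge0.
- by rewrite big_ord_recl big_ord1 /= subrK.
- by rewrite big_ord_recl big_ord1.
Qed.

Lemma conv_hull_ge (A : set 'rV[R]_d) v (a : R) :
  (forall x, A x -> a <= pairing x v) ->
  forall x, conv_hull A x -> a <= pairing x v.
Proof.
move=> hA _ [k [p [c [Ap c0 c1 ->]]]]; rewrite pairing_suml.
rewrite -[a]mul1r -c1 mulr_suml; apply: ler_sum => i _.
by rewrite pairingZl ler_wpM2l // hA.
Qed.

(** The excess over the value at [u] is a sum of nonnegative terms; if it vanishes, all weight sits
    at [u]. *)
Lemma conv_hull_unique_min (A : set 'rV[R]_d) v u :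
  (forall x, A x -> x != u -> pairing u v < pairing x v) ->
  forall x, conv_hull A x -> pairing x v <= pairing u v -> x = u.
Proof.
move=> hA _ [k [p [c [Ap c0 c1 ->]]]].
have pu i : 0 <= pairing (p i) v - pairing u v.
  by rewrite subr_ge0; have [->//|/hA/ltW] := eqVneq (p i) u; exact.
have sum_ge0 i : true -> 0 <= c i * (pairing (p i) v - pairing u v).
  by move=> _; rewrite mulr_ge0.
have -> : pairing (\sum_i c i *: p i) v =
    \sum_i c i * (pairing (p i) v - pairing u v) + pairing u v.
  rewrite -{2}[pairing u v]mul1r -c1 mulr_suml -big_split pairing_suml /=.
  by apply: eq_bigr => i _; rewrite pairingZl; ring.
rewrite gerDr => le0.
have /(psumr_eq0P sum_ge0) cpu0 :
    \sum_i c i * (pairing (p i) v - pairing u v) = 0.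
  by apply/eqP; rewrite eq_le le0 sumr_ge0.
rewrite -[RHS]scale1r -c1 scaler_suml; apply: eq_bigr => i _.
have [->//|piu] := eqVneq (p i) u.
have /eqP := cpu0 i isT; rewrite mulf_eq0 subr_eq0 (gt_eqF (hA _ (Ap i) piu)) orbF.
by move=> /eqP->; rewrite !scale0r.
Qed.

Definition basis_rows (w : 'I_d -> 'rV[int]_d) : 'M[int]_d :=
  \matrix_(i, j) w i 0 j.

Definition basis_cols (g : 'I_d -> 'cV[int]_d) : 'M[int]_d :=
  \matrix_(i, j) g j i 0.

Lemma basis_mulmx w g : dual_bases w g -> basis_rows w *m basis_cols g = 1%:M.
Proof.
move=> [wg _ _]; apply/matrixP => i j; rewrite [RHS]mxE -wg /dot !mxE.
by apply: eq_bigr => k _; rewrite !mxE.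
Qed.

Lemma real_expansion w g x : dual_bases w g ->
  x = \sum_i pairing x (to_real R (g i)) *: to_real R (w i).
Proof.
move=> /basis_mulmx/mulmx1C gw.
have {1}-> : x = x *m to_real R (basis_cols g *m basis_rows w).
  by rewrite gw /to_real map_mx1 mulmx1.
rewrite to_realM mulmxA mulmx_sum_row; apply: eq_bigr => i _; congr (_ *: _).
  by rewrite /pairing !mxE; apply: eq_bigr => k _; rewrite !mxE.
by apply/rowP => j; rewrite !mxE.
Qed.

Definition real_points (S : seq 'rV[int]_d) : set 'rV[R]_d :=
  [set to_real R s | s in [set` S]].

Lemma lattice_polytopeP (P : set 'rV[R]_d) :
  lattice_polytope P -> exists S, P = conv_hull (real_points S).
Proof.
move=> [A [/finite_seqP[s ->] sL ->]].
(* Integer lifts of the generators; the default 0 concerns only points off the lattice. *)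
pose f x := xget 0 [set z : 'rV[int]_d | to_real R z = x].
have fK x : x \in s -> to_real R (f x) = x.
  by move=> /sL[z _ zx]; rewrite /f; case: xgetP => [y _ //|/(_ z)].
exists (map f s); congr conv_hull; apply/seteqP; split=> x.
  by move=> xs; exists (f x); [exact: map_f|exact: fK].
by move=> [z /mapP[y ys ->] <-] /=; rewrite fK.
Qed.

(** * Vertices, normal cones and edges of a lattice polytope *)

Section Polytope.
Variables (S : seq 'rV[int]_d).
Let P := conv_hull (real_points S).

Lemma mem_polytope s : s \in S -> P (to_real R s).
Proof. by move=> sS; apply: conv_hull_sub; exists s. Qed.

Lemma polytope_ge0 (u : 'rV[int]_d) (v : 'cV[int]_d) :
  (forall s, s \in S -> 0 <= dot (s - u) v) ->
  forall x, P x -> 0 <= pairing (x - to_real R u) (to_real R v).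
Proof.
move=> h x Px; rewrite pairingBl subr_ge0; apply: conv_hull_ge Px.
move=> _ [s sS <-]; rewrite !pairing_to_real ler_int.
by have := h s sS; rewrite dotBl subr_ge0.
Qed.

Lemma vertex_of_functional (u : 'rV[int]_d) (v : 'cV[int]_d) : u \in S ->
  (forall s, s \in S -> s != u -> 0 < dot (s - u) v) ->
  is_vertex P (to_real R u).
Proof.
move=> uS h; exists (to_real R v); apply/seteqP; split=> [_ ->|x [Px xmin]].
  split=> [|x Px]; first exact: mem_polytope.
  have h0 s : s \in S -> 0 <= dot (s - u) v.
    move=> sS; have [->|/(h s sS)/ltW//] := eqVneq s u.
    by rewrite subrr /dot mul0mx mxE.
  by have := polytope_ge0 h0 Px; rewrite pairingBl subr_ge0.
apply: conv_hull_unique_min Px (xmin _ (mem_polytope uS)).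
move=> _ [s sS <-] su; rewrite !pairing_to_real ltr_int.
have := h s sS; rewrite dotBl subr_gt0; apply.
by apply: contraNneq su => ->.
Qed.

(** Existence of coordinates gives the right inverse of the generator matrix, uniqueness makes it
    two-sided. Both identities are stated because [k = d] is deduced from them. *)
Lemma lattice_basis_dual k (g : 'I_k -> 'cV[int]_d) : lattice_basis g ->
  exists2 W : 'M[int]_(k, d),
    (\matrix_(a, i) g i a 0) *m W = 1%:M & W *m (\matrix_(a, i) g i a 0) = 1%:M.
Proof.
set G := \matrix_(a, i) g i a 0 => gb.
have GE (c : 'cV_k) : \sum_i c i 0 *: g i = G *m c.
  apply/matrixP => a b; rewrite ord1 summxE !mxE; apply: eq_bigr => i _.
  by rewrite !mxE mulrC.
have /boolp.choice[K KE] : forall a, exists c : 'cV_k, delta_mx a 0 = G *m c.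
  by move=> a; have [c [cE _]] := gb (delta_mx a 0); exists c; rewrite -GE.
exists (\matrix_(i, a) K a i 0).
  apply/matrixP => b a; have /matrixP/(_ b 0) := KE a.
  rewrite !mxE eqxx andbT => ->.
  by apply: eq_bigr => i _; rewrite !mxE.
set W := \matrix_(_, _) _.
have GW : G *m W = 1%:M.
  apply/matrixP => b a; have /matrixP/(_ b 0) := KE a.
  rewrite !mxE eqxx andbT => ->.
  by apply: eq_bigr => i _; rewrite !mxE.
apply/matrixP => i j.
have [c [_ cuniq]] := gb (col j G).
have e1 : c = col j (W *m G).
  by apply: cuniq; rewrite GE !colE !mulmxA GW mul1mx.
have e2 : c = col j 1%:M by apply: cuniq; rewrite GE !colE mul1mx.
by have := congr1 (fun A : 'cV_k => A i 0) (etrans (esym e1) e2); rewrite !mxE.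
Qed.

(** The cone generators serve as [g], their dual basis as [w]. With no point of [S] on the ray of
    [w i], a tilted functional would lie in the normal cone although its [g i]-coefficient is -1. *)
Lemma unimodular_corner u : u \in S ->
  unimodular_cone (normal_cone P (to_real R u)) ->
  exists w g, corner S u w g.
Proof.
move=> uS [k [g [[_ span _] gb]]].
have [W GW WG] := lattice_basis_dual gb.
(* The two products of [W] with the generator matrix have equal traces, [d] and [k]. *)
have kd : k = d.
  have := congr1 mxtrace GW; rewrite mxtrace_mulC WG !mxtrace1 => /eqP.
  by rewrite eqr_nat => /eqP.
subst k.
have wg : dual_bases (fun i => row i W) g.
  have := dual_bases_mx WG; rewrite (_ : (fun j => col j _) = g) //.
  by apply/funext => j; apply/matrixP => a b; rewrite ord1 !mxE.
have [wgE _ _] := wg.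
have pos s i : s \in S -> 0 <= dot (s - u) (g i).
  move=> sS; rewrite -(ler0z R) -pairing_to_real to_realB.
  have : normal_cone P (to_real R u) (to_real R (g i)).
    rewrite -span; exists (fun j => (j == i)%:R); split.
      by move=> j; rewrite ler0n.
    rewrite (bigD1 i) ?finset.in_setT //= eqxx scale1r big1 ?addr0 //.
    by move=> j /andP[_ /negPf->]; rewrite scale0r.
  by apply; exact: mem_polytope.
exists (fun i => row i W), g; split=> // i.
apply: contrapT => noray.
have [v wv hv] := tilted_functional i wg pos.
have : normal_cone P (to_real R u) (to_real R v).
  apply: polytope_ge0 => s sS; have [//|sE] := hv s sS.
  have t0 := pos s i sS.
  have [t00|tn0] := eqVneq (dot (s - u) (g i)) 0.
    by rewrite sE t00 scale0r addr0 subrr /dot mul0mx mxE.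
  exfalso; apply: noray; exists (dot (s - u) (g i)); last by rewrite -sE.
  by rewrite lt0r tn0.
rewrite -span => -[c [c0 vE]].
have := pairing_to_real (row i W) v.
rewrite vE pairing_sumr (bigD1 i) ?finset.in_setT //= big1.
  rewrite addr0 pairingZr pairing_to_real wgE eqxx mulr1 wv => ciE.
  by have := c0 i; rewrite ciE ler0z.
move=> j /andP[_ ji]; rewrite pairingZr pairing_to_real wgE eq_sym (negPf ji).
by rewrite mulr0.
Qed.

(** The face minimizing [v0] lies on the line through [u] along [w i], because its points have zero
    coordinates at all other indices, and it contains the two distinct points [u] and
    [u + t *: w i]. *)
Lemma corner_edge u w g i (t r : int) : corner S u w g -> 0 < t ->
  u + t *: w i \in S -> 0 <= r <= t ->
  edge_lattice_points P (to_real R (u + r *: w i)).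
Proof.
move=> [uS wg pos _] t0 tS /andP[r0 rt]; have [wgE _ _] := wg.
split; first by exists (u + r *: w i).
pose v0 := \sum_(j | j != i) g j.
have uv0 a : dot (u + a *: w i) v0 = dot u v0.
  rewrite !dotE [dot (w i) v0]dot_sumr big1 ?mulr0 ?addr0 // => j ji.
  by rewrite wgE eq_sym (negPf ji).
pose F := [set x | P x /\ forall x', P x' ->
  pairing x (to_real R v0) <= pairing x' (to_real R v0)].
have v0pos s : s \in S -> 0 <= dot (s - u) v0.
  by move=> sS; rewrite dot_sumr sumr_ge0 // => j _; exact: pos.
have umin x : P x -> pairing (to_real R u) (to_real R v0) <=
    pairing x (to_real R v0).
  by move=> /(polytope_ge0 v0pos); rewrite pairingBl subr_ge0.
have Fr (a : int) : 0 <= a <= t -> F (to_real R (u + a *: w i)).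
  move=> /andP[a0 at_]; split; last first.
    by move=> x /umin; rewrite !pairing_to_real uv0.
  have -> : to_real R (u + a *: w i) = (1 - a%:~R / t%:~R) *: to_real R u +
      (a%:~R / t%:~R) *: to_real R (u + t *: w i).
    rewrite !to_realD !to_realZ scalerDr scalerA divfK ?intr_eq0 ?gt_eqF //.
    by rewrite addrA -scalerDl subrK scale1r.
  apply: conv_hull_segment; [by exists u|by exists (u + t *: w i)|].
  rewrite divr_ge0 ?ler0z ?(ltW t0) //=.
  by rewrite ler_pdivrMr ?ltr0z // mul1r ler_int.
exists F; last by apply: Fr; rewrite r0.
split; first by exists (to_real R v0).
have Fline x : F x -> exists a, x = to_real R u + a *: to_real R (w i).
  move=> [Px /(_ _ (mem_polytope uS)) xle].
  have x0 : pairing (x - to_real R u) (to_real R v0) = 0.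
    by rewrite pairingBl; apply/eqP; rewrite subr_eq0 eq_le xle umin.
  have gpos j : j != i -> 0 <= pairing (x - to_real R u) (to_real R (g j)).
    by move=> _; apply: polytope_ge0 => // s sS; exact: pos.
  exists (pairing (x - to_real R u) (to_real R (g i))).
  rewrite -[LHS](subrK (to_real R u)) addrC; congr (_ + _).
  rewrite {1}(real_expansion (x - to_real R u) wg) (bigD1 i) //=.
  rewrite big1 ?addr0 // => j ji.
  have : \sum_(j | j != i) pairing (x - to_real R u) (to_real R (g j)) = 0.
    by rewrite -pairing_sumr -x0 /to_real raddf_sum.
  by move=> /(psumr_eq0P gpos)/(_ j ji)->; rewrite scale0r.
exists (to_real R u), (to_real R (w i)); split.
  rewrite /row_free rank_rV; have [w0|//] := eqVneq (to_real R (w i)) 0.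
  have := pairing_to_real (w i) (g i); rewrite w0 wgE eqxx /pairing mul0mx mxE.
  by move=> /esym/eqP; rewrite oner_eq0.
apply/seteqP; split=> [_ [k [p [c [Fp c1 ->]]]]|_ [c _ <-]].
  have /boolp.choice[a aE] := fun j => Fline _ (Fp j).
  exists (\sum_j c j * a j)%:M => //.
  rewrite mul_scalar_mx scaler_suml -[to_real R u]scale1r -c1 scaler_suml.
  rewrite -big_split; apply: eq_bigr => j _ /=.
  by rewrite aE scalerDr scalerA.
rewrite [c]mx11_scalar mul_scalar_mx; set a := c 0 0.
exists 2%N, (fun j => if val j == 0%N then to_real R u
                      else to_real R (u + t *: w i)),
  (fun j => if val j == 0%N then 1 - a / t%:~R else a / t%:~R); split.
- move=> j; case: ifP => _.
    by have := Fr 0; rewrite scale0r addr0; apply; rewrite lexx ltW.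
  by apply: Fr; rewrite lexx ltW.
- by rewrite big_ord_recl big_ord1 /= subrK.
- rewrite big_ord_recl big_ord1 /= to_realD to_realZ scalerDr scalerA.
  by rewrite divfK ?intr_eq0 ?gt_eqF // addrA -scalerDl subrK scale1r.
Qed.

Lemma edge_points_count n (L : seq 'rV[int]_d) :
  (edge_lattice_points P #= `I_n)%card -> uniq L ->
  (forall z, z \in L -> edge_lattice_points P (to_real R z)) ->
  (size L <= n)%N.
Proof.
move=> En uL LE; have finE : finite_set (edge_lattice_points P) by exists n.
rewrite -(card_fset_set En) -(size_map (@to_real R 1 d)).
apply: uniq_leq_size; first by rewrite map_inj_uniq //; exact: to_real_inj.
by move=> _ /mapP[z zL ->]; rewrite in_fset_set // inE; exact: LE.
Qed.

Lemma smooth_box n : smooth_polytope P -> (edge_lattice_points P #= `I_n)%card ->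
  (d <= n)%N /\
  exists u w g, dual_bases w g /\
    forall s i, s \in S -> 0 <= dot (s - u) (g i) <= climb_bound n n 1.
Proof.
move=> [_ [x0 [B [_ affP]]] smooth] En.
(* The affine hull contains [x0], whereas that of the empty set is empty. *)
have S0 : S != [::].
  apply: contraPneq affP => S0 /seteqP[_ /(_ x0)].
  case; first by exists 0; rewrite ?mul0mx ?addr0.
  move=> [|k] [p [c [Pp c1 _]]].
    by move: c1; rewrite big_ord0 => /esym/eqP; rewrite oner_eq0.
  have [[|m] [q [b [Sq _ b1 _]]]] := Pp ord0.
    by move: b1; rewrite big_ord0 => /esym/eqP; rewrite oner_eq0.
  by have [s] := Sq ord0; rewrite /= S0.
have vertex_corner (u : 'rV[int]_d) (v : 'cV[int]_d) : u \in S ->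
    (forall s, s \in S -> s != u -> 0 < dot (s - u) v) ->
    exists w g, corner S u w g.
  move=> uS h; apply: (unimodular_corner uS); apply: smooth.
  exact: vertex_of_functional h.
have [u [w [g C]]] := exists_corner vertex_corner S0.
have [uS wg pos ray] := C; have [wgE _ _] := wg.
split.
  rewrite -(size_enum_ord d) -(size_map (fun i => u + w i)).
  apply: (edge_points_count En).
    rewrite map_inj_uniq ?enum_uniq // => i j /addrI wij.
    have := wgE i j; rewrite wij wgE eqxx; by case: eqVneq.
  move=> _ /mapP[i _ ->]; have [t t0 tS] := ray i.
  by rewrite -[w i]scale1r; apply: (corner_edge C t0 tS); rewrite ler01 -gtz0_ge1.
exists u, w, g; split=> // s i sS; rewrite pos //=.
(* This list may contain points other than vertices, but they are edge points, so at most [n]. *)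
pose corners := [seq z <- undup S | `[< edge_lattice_points P (to_real R z) >]].
apply: (corner_box (S := S) vertex_corner (corners := corners)) C sS.
- move=> u' w' g' j t C' tS.
  have [t0|t0] := leP t 0; first by lia.
  have [_ wg' _ _] := C'; have [wgE' _ _] := wg'.
  have -> : t = (absz t)%:Z by lia.
  (* An edge segment of lattice length [t] carries [t + 1] lattice points. *)
  rewrite lez_nat; apply: leq_trans (leqnSn _) _.
  rewrite -(size_iota 0 (absz t).+1).
  rewrite -(size_map (fun k : nat => u' + k%:Z *: w' j)).
  apply: (edge_points_count En).
    rewrite map_inj_uniq ?iota_uniq // => k m /addrI/(congr1 (fun z => dot z (g' j))).
    by rewrite !dotZl wgE' eqxx !mulr1 => -[].
  move=> _ /mapP[k + ->]; rewrite mem_iota => kt.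
  by apply: (corner_edge C' t0 tS); lia.
- move=> u' w' g' C'; have [u'S _ _ ray'] := C'.
  rewrite mem_filter mem_undup u'S andbT; apply/asboolP.
  (* The index [i] supplies an edge through [u']; in dimension 0 there would be none. *)
  have [t t0 tS] := ray' i.
  rewrite -[u']addr0 -(scale0r (w' i)).
  by apply: (corner_edge C' t0 tS); rewrite lexx ltW.
- apply: (edge_points_count En); first by rewrite filter_uniq ?undup_uniq.
  by move=> z; rewrite mem_filter => /andP[/asboolP].
Qed.

End Polytope.

(** * Lattice charts and finite codes *)

Definition affine_map (u : 'rV[R]_d) (M : 'M[R]_d) (x : 'rV[R]_d) := u + x *m M.

Lemma affine_map_sum u M k (p : 'I_k -> 'rV[R]_d) (c : 'I_k -> R) :
  \sum_i c i = 1 ->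
  affine_map u M (\sum_i c i *: p i) = \sum_i c i *: affine_map u M (p i).
Proof.
move=> c1; rewrite /affine_map mulmx_suml -{1}[u]scale1r -c1 scaler_suml.
by rewrite -big_split; apply: eq_bigr => i _; rewrite /= scalerDr scalemxAl.
Qed.

Lemma conv_hull_affine_map u M (A : set 'rV[R]_d) :
  conv_hull (affine_map u M @` A) = affine_map u M @` conv_hull A.
Proof.
apply/seteqP; split=> [_ [k [p [c [Ap c0 c1 ->]]]]|_ [_ [k [p [c [Ap c0 c1 ->]]]] <-]].
  have /boolp.choice[q qP] : forall i, exists q, A q /\ affine_map u M q = p i.
    by move=> i; have [q] := Ap i; exists q.
  exists (\sum_i c i *: q i); last first.
    by rewrite affine_map_sum //; apply: eq_bigr => i _; rewrite (qP i).2.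
  by exists k, q, c; split=> // i; case: (qP i).
exists k, (fun i => affine_map u M (p i)), c; split=> //.
  by move=> i; exists (p i).
exact: affine_map_sum.
Qed.

(* A code is a finite set of lattice points in the cube [0, b]^d. *)
Definition code_points b (C : {set {ffun 'I_d -> 'I_b.+1}}) : set 'rV[R]_d :=
  [set to_real R (\row_i (f i)%:Z) | f in [set` C]].

(** [G] witnesses that [W] is invertible over the integers, so the affine map preserves the
    lattice. *)
Definition has_code b (P : set 'rV[R]_d) (C : {set {ffun 'I_d -> 'I_b.+1}}) :=
  exists (u : 'rV[int]_d) (W G : 'M[int]_d), W *m G = 1%:M /\
    P = affine_map (to_real R u) (to_real R W) @` conv_hull (code_points C).

Lemma box_has_code (S : seq 'rV[int]_d) u w g (b : nat) : dual_bases w g ->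
  (forall s i, s \in S -> 0 <= dot (s - u) (g i) <= b%:Z) ->
  exists C : {set {ffun 'I_d -> 'I_b.+1}},
    has_code (conv_hull (real_points S)) C.
Proof.
move=> wg box; have [_ ex _] := wg.
pose coord s : {ffun 'I_d -> 'I_b.+1} :=
  [ffun i => inord (absz (dot (s - u) (g i)))].
have coordE s i : s \in S -> (coord s i)%:Z = dot (s - u) (g i).
  move=> sS; have /andP[lo hi] := box s i sS.
  by rewrite ffunE inordK ?gez0_abs // ltnS -lez_nat gez0_abs.
have sE s : s \in S -> to_real R s =
    affine_map (to_real R u) (to_real R (basis_rows w))
      (to_real R (\row_i (coord s i)%:Z)).
  move=> sS; rewrite /affine_map -to_realM -to_realD; congr to_real.
  rewrite -[LHS](subrK u) addrC; congr (_ + _).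
  rewrite [LHS]ex mulmx_sum_row; apply: eq_bigr => i _.
  rewrite mxE coordE //; congr (_ *: _).
  by apply/rowP => j; rewrite !mxE.
exists [set f | f \in map coord S]%SET, u, (basis_rows w), (basis_cols g).
split; first exact: basis_mulmx.
rewrite -conv_hull_affine_map; congr conv_hull; apply/seteqP; split=> x.
  move=> [s sS <-].
  exists (to_real R (\row_i (coord s i)%:Z)); last by rewrite -sE.
  by exists (coord s) => //=; rewrite inE map_f.
move=> [_ [f fC <-] <-]; move: fC; rewrite /= inE => /mapP[s sS ->].
by rewrite -sE //; exists s.
Qed.

(** The equivalence undoes the first chart and applies the second; full dimension makes both affine
    hulls the whole space. *)
Lemma has_code_equivalent b P P' (C : {set {ffun 'I_d -> 'I_b.+1}}) :
  has_dim P d -> has_dim P' d -> has_code P C -> has_code P' C ->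
  integrally_equivalent P P'.
Proof.
have full (Q : set 'rV[R]_d) : has_dim Q d -> aff_hull Q = setT.
  move=> [x [B [Bfree ->]]]; apply/seteqP; split=> // y _.
  exists ((y - x) *m invmx B) => //.
  by rewrite mulmxKV -?row_free_unit // addrC subrK.
move=> /full hP /full hP' [u1 [W1 [G1 [WG1 PE]]]] [u2 [W2 [G2 [WG2 PE']]]].
have WG1R : to_real R W1 *m to_real R G1 = 1%:M.
  by rewrite -to_realM WG1 /to_real map_mx1.
pose f x := affine_map (to_real R u2) (to_real R W2)
  ((x - to_real R u1) *m to_real R G1).
have fZ z : f (to_real R z) = to_real R (u2 + (z - u1) *m G1 *m W2).
  by rewrite /f /affine_map -to_realB -!to_realM -to_realD.
exists f; rewrite hP hP' !setIT; split=> //.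
- move=> t x y _ _; rewrite /f /affine_map.
  have -> : t *: x + (1 - t) *: y - to_real R u1 =
      t *: (x - to_real R u1) + (1 - t) *: (y - to_real R u1).
    by apply/rowP => j; rewrite !mxE; ring.
  move: (x - _) (y - _) => {}x {}y; rewrite !mulmxDl -!scalemxAl.
  move: (x *m _ *m _) (y *m _ *m _) => {}x {}y.
  by apply/rowP => j; rewrite !mxE; ring.
- split=> [_ [z _ <-]|_ _ /set_mem[z _ <-] /set_mem[z' _ <-]|_ [z _ <-]].
  + by rewrite fZ; eexists.
  + rewrite !fZ => /to_real_inj/addrI.
    move=> /(congr1 (mulmx^~ (G2 *m W1))); rewrite !mulmxA.
    rewrite -!(mulmxA _ W2) WG2 !mulmx1 -!(mulmxA _ G1) (mulmx1C WG1) !mulmx1.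
    by move=> /addIr->.
  + exists (to_real R (u1 + (z - u2) *m G2 *m W1)); first by eexists.
    rewrite fZ; congr to_real.
    rewrite shiftK -!mulmxA (mulmxA W1) WG1 mul1mx (mulmx1C WG2) mulmx1.
    by rewrite addrC subrK.
- rewrite PE PE'; apply/seteqP; split=> [_ [_ [x Cx <-] <-]|_ [x Cx <-]].
    by exists x => //; rewrite /f /affine_map shiftK -(mulmxA x) WG1R mulmx1.
  exists (affine_map (to_real R u1) (to_real R W1) x); first by exists x.
  by rewrite /f /affine_map shiftK -(mulmxA x) WG1R mulmx1.
Qed.

End RealPolytopes.

(** * Choice of representatives and conclusion *)

(** One good element is chosen per attained code; [t0] fills the other codes, which are left out of
    [reps]. *)
Lemma finite_representatives (T : Type) (C : finType) (t0 : T)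
    (good : set T) (code : T -> C -> Prop) :
  (forall x, good x -> exists c, code x c) ->
  exists reps : set T, [/\ finite_set reps, reps `<=` good &
    forall x, good x -> exists2 y, reps y & exists c, code x c /\ code y c].
Proof.
move=> total.
have /boolp.choice[f fP] : forall c, exists x,
    (exists x', good x' /\ code x' c) -> good x /\ code x c.
  move=> c; have [[x xP]|no] := pselect (exists x', good x' /\ code x' c).
    by exists x.
  by exists t0.
exists (f @` [set c | exists x, good x /\ code x c]); split.
- exact/finite_image/finite_finset.
- by move=> _ [c /fP[gc _] <-].
- move=> x gx; have [c xc] := total x gx.
  have ex : exists x, good x /\ code x c by exists x.
  by exists (f c); [exists c|exists c; split=> //; case: (fP c ex)].
Qed.


Theorem theorem3 (R : realType) (n : nat) :
  exists reps : set {d : nat & set 'rV[R]_d},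
    [/\ finite_set reps,
        reps `<=` smooth_with_edge_points R n &
        forall P, smooth_with_edge_points R n P ->
          exists2 Q, reps Q & integrally_equivalent (projT2 P) (projT2 Q)].
Proof.
pose b := absz (climb_bound n n 1).
have box d (P : set 'rV[R]_d) :
    smooth_polytope P -> (edge_lattice_points P #= `I_n)%card ->
    (d <= n)%N /\ exists C : {set {ffun 'I_d -> 'I_b.+1}}, has_code P C.
  move=> Psm En; have [/lattice_polytopeP[S PE] _ _] := Psm; subst P.
  have [dn [u [w [g [wg sb]]]]] := smooth_box Psm En.
  split=> //; apply: (box_has_code R wg (u := u) (b := b)) => s i /(sb s i).
  by rewrite /b gez0_abs ?climb_bound_ge0.
pose good d (P : set 'rV[R]_d) :=
  smooth_polytope P /\ (edge_lattice_points P #= `I_n)%card.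
(* The type of codes depends on [d], so representatives are chosen in each dimension and then
   collected over [d <= n]. *)
have ex d : exists reps : set (set 'rV[R]_d),
    [/\ finite_set reps, reps `<=` @good d & forall P, good d P ->
      exists2 Q, reps Q &
      exists C : {set {ffun 'I_d -> 'I_b.+1}}, has_code P C /\ has_code Q C].
  apply: (finite_representatives set0) => P [Psm En].
  by case: (box d P Psm En).
pose reps d := sval (cid (ex d)); have repsP d := svalP (cid (ex d)).
exists (\bigcup_(d in [set d | (d <= n)%N]) (existT _ d @` reps d)); split.
- apply: bigcup_finite => [|d _].
    by apply: sub_finite_set (finite_II n.+1) => d; rewrite /= ltnS.
  by apply: finite_image; case: (repsP d).
- by move=> _ [d _ [P Pd <-]]; have [_ + _] := repsP d; exact.
- move=> [d P] /= [Psm En].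
  have [_ sub cov] := repsP d.
  have [Q Qd [C [PC QC]]] := cov P (conj Psm En).
  exists (existT _ d Q); first by exists d; [case: (box d P Psm En)|exists Q].
  have [[_ Pdim _] _] := (Psm, En); have [[_ Qdim _] _] := sub Q Qd.
  exact: has_code_equivalent PC QC.
Qed.
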